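(* Consider a repeated first price auction with two bidders ($n=2$) and value/bid grid $V=\{\frac1H,\frac2H,\dots,1\}$, where $H$ is an even positive integer and each bidder's value in each round is drawn i.i.d. uniformly from $V$. Both bidders run the learning algorithm consisting of $T_0$ rounds of pure uniform exploration followed by a $\gamma_t$-mean-based contextual learning algorithm. Suppose $T_0$ is large enough that $\gamma_t\le\frac{1}{4H^3}$ for all $t\ge T_0$. Then for every time $t>T_0$, each bidder $i$, and every fixed value $v\in V$, given $v_{i,t}=v$, bidder $i$ submits a bid $b_{i,t}$ satisfying $$\frac v2\le b_{i,t}<\frac v2+\frac1H$$ with probability at least $$1-H\gamma_t-\exp\left(-\frac{(H-1)T_0}{32(4H^3+1)H^4}\right)\frac{\log t}{\log\left(\frac{4H^3+H}{4H^3+1}\right)} .$$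
   Context: Setting. $V=\{\frac1H,\frac2H,\dots,1\}$. There are two bidders and rounds $t=1,2,\dots$; in each round one good is sold. Bidder $i$'s value $v_{i,t}\in V$ is drawn independently over rounds and across bidders, and bidder $i$ submits a bid $b_{i,t}\in V$ depending on $v_{i,t}$, past information and private randomness (independent across bidders). Write $b_{-i,t}$ for the bid of the other bidder and $m_{i,t}$ for the value of that bid. First price auction. $u_{i,t}((b,b_{-i,t});v)$ denotes the utility of bidder $i$ in round $t$ when she has value $v$, bids $b$, and the other bidder bids $b_{-i,t}$. It equals $v-b$ if bidder $i$ wins and $0$ otherwise; bidder $i$ wins if $b>m_{i,t}$, loses if $b<m_{i,t}$, and if $b=m_{i,t}$ the winner is chosen uniformly at random. Mean-based contextual learning algorithm. Let $r_{a,t}(c)$ be the reward of action $a$ at time $t$ when the context is $c$, and $\sigma_{a,t}(c)=\sum_{s=1}^t r_{a,s}(c)$. An algorithm is $\gamma_t$-mean-based if whenever $\sigma_{a,t}(c)<\sigma_{b,t}(c)-\gamma_t t$, the probability that the algorithm plays action $a$ on round $t+1$, given context $c$, is at most $\gamma_t$. Here $(\gamma_t)$ is a sequence such that $\gamma_t t$ is increasing in $t$ and $\gamma_t\to0$ as $t\to\infty$. For bidder $i$ the context in round $t$ is her value, the actions are the bids in $V$, and the reward of bid $b$ in context $v$ at time $t$ is $u_{i,t}((b,b_{-i,t});v)$ (defined for every $v\in V$ and every $b\in V$ in every round, including exploration rounds). Bidders' algorithm with parameters $(\gamma_t,T_0)$. For $t=1,\dots,T_0$ each bidder chooses $b_{i,t}$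 uniformly at random from $V$ (regardless of her value, independently across bidders and rounds). For $t>T_0$ she observes $v_{i,t}$ and chooses $b_{i,t}$ by a $\gamma_t$-mean-based contextual learning algorithm. Both bidders share the same $\gamma_t$ and $T_0$. *)

(* Defs.v *)
From HB Require Import structures.
From mathcomp Require Import all_boot all_order all_algebra.
From mathcomp Require Import all_classical all_reals all_analysis.
Set Implicit Arguments.
Unset Strict Implicit.
Unset Printing Implicit Defensive.
Import Order.TTheory GRing.Theory Num.Theory.
Import numFieldNormedType.Exports.
Local Open Scope classical_set_scope.
Local Open Scope ring_scope.

(* [~~ i] is the opponent of [i]. *)
Notation bidder := bool.

(* The grid V = {1/H, 2/H, ..., 1} is indexed by 'I_H. *)
Definition grid (R : realType) (H : nat) (k : 'I_H) : R := k.+1%:R / H%:R.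

(* One round: the values, the bids, and the bidder who gets the good in case
   of a tie. *)
Definition round (H : nat) : Type :=
  ({ffun bidder -> 'I_H} * {ffun bidder -> 'I_H} * bidder)%type.

Section Rewards.
Context (R : realType) (H : nat).

Definition wins (i : bidder) (b m : 'I_H) (w : bidder) : bool :=
  (grid R m < grid R b) || ((grid R m == grid R b) && (w == i)).

(* Utility of bidder [i] with value [v] and bid [b] against the bid [m], when
   [w] is the winner of a tie.  It is the realized utility: a tie is settled
   by [w] and not averaged. *)
Definition utility (i : bidder) (v b m : 'I_H) (w : bidder) : R :=
  if wins i b m w then grid R v - grid R b else 0.

(* The reward in the round [r] of the action [a] in the context [c]; both are
   hypothetical: only the opponent's bid and the tie-break come from [r]. *)
Definition reward (i : bidder) (a c : 'I_H) (r : round H) : R :=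
  utility i c a (r.1.2 (~~ i)) r.2.

Definition cumulative_reward (i : bidder) (a c : 'I_H) (h : seq (round H)) : R :=
  \sum_(r <- h) reward i a c r.

End Rewards.

Section Probability.
Context (R : realType) (d : measure_display) (Omega : measurableType d)
  (P : probability Omega R).

(* Pr(A | B), for Pr(B) > 0. *)
Definition cond_prob (A B : set Omega) : R :=
  fine (P (A `&` B)) / fine (P B).

Definition mutually_independent (K : eqType) (F : K -> set (set Omega)) : Prop :=
  forall (s : seq K) (E : K -> set Omega), uniq s ->
    (forall k, k \in s -> F k (E k)) ->
    P (\bigcap_(k in [set` s]) E k) = (\prod_(k <- s) P (E k))%E.

End Probability.

(* The primitive random variables.  [explore X i t] is the uniform bid of
   bidder [i] if [t] is an exploration round, [tie X t] the bidder favoured by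
   the tie-breaking rule in round [t], and [seed X i] the private randomness of
   bidder [i] for all rounds together.  Rounds are numbered from 1. *)
Record primitives (H : nat) (Omega S : Type) := Primitives {
  value : bidder -> nat -> Omega -> 'I_H;
  explore : bidder -> nat -> Omega -> 'I_H;
  tie : nat -> Omega -> bidder;
  seed : bidder -> Omega -> S }.

Inductive source :=
  | Value of bidder & nat
  | Explore of bidder & nat
  | Tie of nat
  | Seed of bidder.

HB.instance Definition _ := gen_eqMixin source.

Section Run.
Context (R : realType) (H : nat) (d : measure_display) (Omega : measurableType d)
  (P : probability Omega R) (dS : measure_display) (S : measurableType dS).

(* The events determined by one primitive random variable. *)
Definition events_of (X : primitives H Omega S) (k : source) : set (set Omega) :=
  match k with
  | Value i t => preimage_set_system setT (value X i t) setT
  | Explore i t => preimage_set_system setT (explore X i t) setT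
  | Tie t => preimage_set_system setT (tie X t) setT
  | Seed i => preimage_set_system setT (seed X i) measurable
  end.

Record primitives_law (X : primitives H Omega S) : Prop := PrimitivesLaw {
  events_measurable : forall k E, events_of X k E -> measurable E;
  sources_independent : mutually_independent P (events_of X);
  value_uniform : forall i t v, (0 < t)%N ->
    P (value X i t @^-1` [set v]) = (H%:R^-1)%:E;
  explore_uniform : forall i t b, (0 < t)%N ->
    P (explore X i t @^-1` [set b]) = (H%:R^-1)%:E;
  tie_uniform : forall t w, (0 < t)%N ->
    P (tie X t @^-1` [set w]) = (2^-1)%:E }.

(* A bidder's algorithm after the exploration: the bid as a function of the
   past rounds, the current value and the bidder's private randomness. *)
Definition algorithm : Type := seq (round H) -> 'I_H -> S -> 'I_H.

Definition measurable_algorithm (alg : algorithm) : Prop :=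
  forall h v b, measurable [set s | alg h v s = b].

Context (T0 : nat) (X : primitives H Omega S) (alg : bidder -> algorithm).

(* The bid in round [t] after the past rounds [h]. *)
Definition bid_after (h : seq (round H)) (i : bidder) (t : nat) (o : Omega) : 'I_H :=
  if (t <= T0)%N then explore X i t o
  else alg i h (value X i t o) (seed X i o).

(* The rounds 1, ..., t. *)
Fixpoint history (t : nat) (o : Omega) : seq (round H) :=
  if t is t'.+1 then
    let h := history t' o in
    rcons h ([ffun i => value X i t o], [ffun i => bid_after h i t o], tie X t o)
  else [::].

Definition bid (i : bidder) (t : nat) (o : Omega) : 'I_H :=
  bid_after (history t.-1 o) i t o.

(* The context of bidder [i] in round [t + 1] is [c]. The probability that the
   algorithm plays [a] is conditional on the past rounds [h] and on [c]. *)
Definition mean_based (gamma : nat -> R) (i : bidder) : Prop :=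
  forall (t : nat) (h : seq (round H)) (c a b : 'I_H), (T0 <= t)%N ->
    let past := [set o | history t o = h /\ value X i t.+1 o = c] in
    (0 < P past)%E ->
    cumulative_reward R i a c h < cumulative_reward R i b c h - gamma t * t%:R ->
    cond_prob P [set o | bid i t.+1 o = a] past <= gamma t.

End Run.

(* Main.v *)
Require Import Defs.
From HB Require Import structures.
From mathcomp Require Import all_boot all_order all_algebra.
From mathcomp Require Import all_classical all_reals all_analysis.
From mathcomp Require Import zify ring lra.
Set Implicit Arguments.
Unset Strict Implicit.
Import Order.TTheory GRing.Theory Num.Theory.
Import numFieldNormedType.Exports.
Local Open Scope classical_set_scope.
Local Open Scope ring_scope.

(* Writing values and bids as indices [k] for [(k + 1)/H], the bid claimed for
   the value [c] is [c./2]: it is the unique best response both to uniform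
   bids and to an opponent who bids [c'./2] for a uniform value [c'], and it
   beats any other bid by at least [1/(2 H^2)] on average.  As long as every
   past margin of [c./2] over another bid exceeds [t/(4 H^3)], the mean-based
   property makes the opponent play almost that best response, so the margins
   keep a positive drift.  The exponential moments of the margins, restricted
   to the histories that never violated the bound, therefore decay
   geometrically; a union bound over all rounds [s >= T0] and all margins
   controls the probability of a violation, and outside of it the mean-based
   property gives the claim. *)

(** * Deviations of adapted sums *)

Lemma big_tuple_rcons (V : nmodType) (T : finType) (n : nat) (F : seq T -> V) :
  \sum_(h : n.+1.-tuple T) F h =
  \sum_(h : n.-tuple T) \sum_(r : T) F (rcons h r).
Proof.
rewrite pair_big /=.
pose f (hr : n.-tuple T * T) : n.+1.-tuple T := [tuple of rcons hr.1 hr.2].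
pose g (h : n.+1.-tuple T) : n.-tuple T * T :=
  ([tuple of belast (thead h) (behead h)], last (thead h) (behead h)).
rewrite (reindex f) /=; first by apply: eq_bigr => -[h r] _.
exists g => [[h r] _|h _].
  rewrite /f /g; congr pair.
    apply: val_inj => /=; case: h => -[|x s] //= hs.
    by rewrite /thead /= (tnth_nth x) /= belast_rcons.
  by case: h => -[|x s] //= hs; rewrite /thead (tnth_nth r) //= last_rcons.
apply: val_inj; rewrite /f /g /=; case/tupleP: h => x s /=.
by rewrite theadE -lastI.
Qed.

Section Deviation.
Context (R : realType) (T J : finType) (p : seq T -> R) (X : J -> T -> R).
Context (T0 : nat) (th la c : R).

Definition above (h : seq T) : bool :=
  [forall j, (T0 <= size h)%N ==> (th * (size h)%:R < \sum_(r <- h) X j r)].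

(** Testing every prefix makes a violation final: a history can only be extended inside the event
    from a prefix that is itself inside, which is where the drift is available. *)
Definition stays_above (h : seq T) : bool :=
  all (fun k => above (take k h)) (iota 0 (size h).+1).

Lemma stays_above_rcons h r :
  stays_above (rcons h r) = stays_above h && above (rcons h r).
Proof.
rewrite /stays_above size_rcons -[(size h).+2]addn1 iotaD all_cat.
rewrite [all _ (iota (0 + _) 1)]/=.
rewrite add0n andbT [take (size h).+1 _]take_oversize ?size_rcons //.
congr (_ && _).
apply: eq_in_all => k; rewrite mem_iota add0n ltnS => /andP[_ lek].
by rewrite -cats1 takel_cat.
Qed.

Lemma stays_above_margin h j : stays_above h -> (T0 <= size h)%N ->
  th * (size h)%:R < \sum_(r <- h) X j r.
Proof.
move=> /allP /(_ (size h)); rewrite mem_iota leq0n ltnSn take_size => /(_ isT).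
by move=> /forallP /(_ j) /implyP.
Qed.

Hypothesis T0_gt0 : (0 < T0)%N.
Hypothesis la_ge0 : 0 <= la.
Hypothesis c_gt0 : 0 < c.
Hypothesis p_ge0 : forall h, 0 <= p h.
Hypothesis p_nil : p [::] = 1.
Hypothesis p_rcons : forall h, \sum_r p (rcons h r) = p h.
(** A Chernoff condition with parameter [la]. The factor [expR (- (la * th))] pays in each round for
    the growing level [th * t] in Markov's inequality, and [expR (- c)] is what remains. *)
Hypothesis drift : forall h j, stays_above h ->
  \sum_r p (rcons h r) * expR (- (la * X j r)) <= expR (- (c + la * th)) * p h.

Let stays_above_nil : stays_above [::].
Proof.
(* The condition is vacuous at length 0 because [T0 > 0]; otherwise it would demand [0 < 0]. *)
by rewrite /stays_above /= andbT; apply/forallP => j; rewrite leqNgt T0_gt0.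
Qed.

Let moment t j :=
  \sum_(h : t.-tuple T | stays_above h)
    p h * expR (- (la * \sum_(r <- h) X j r)).

(** The prefix is restricted but the new round is not: [drift] needs only the prefix, and
    [mass_step] needs the violating extensions to be included. *)
Let moment_step t j :
  \sum_(h : t.-tuple T | stays_above h) \sum_r
     p (rcons h r) * expR (- (la * \sum_(x <- rcons h r) X j x))
  <= expR (- (c + la * th)) * moment t j.
Proof.
rewrite mulr_sumr; apply: ler_sum => h hok.
under eq_bigr do rewrite big_rcons /= mulrDr opprD addrC expRD mulrA.
rewrite -mulr_suml mulrA; apply: ler_wpM2r; first exact: expR_ge0.
exact: drift.
Qed.

(** Induction with [moment_step]; discarding the violating extensions only removes nonnegative
    terms. *)
Let moment_le t j : moment t j <= expR (- (c + la * th)) ^+ t.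
Proof.
elim: t => [|t IHt].
  rewrite expr0 /moment (big_pred1 [tuple]) /= => [|h].
    by rewrite p_nil mul1r big_nil mulr0 oppr0 expR0.
  by rewrite tuple0 stays_above_nil; apply/esym/eqP.
rewrite exprS; apply: (le_trans _ (ler_wpM2l _ IHt)); last exact: expR_ge0.
apply: le_trans (moment_step t j).
rewrite /moment big_mkcond.
rewrite (big_tuple_rcons t (fun h => if stays_above h then
  p h * expR (- (la * \sum_(r <- h) X j r)) else 0)).
rewrite [leRHS]big_mkcond; apply: ler_sum => h _.
case: ifPn => hok; last by rewrite big1 // => r _; rewrite stays_above_rcons (negbTE hok).
apply: ler_sum => r _; case: ifP => // _.
by rewrite mulr_ge0 // expR_ge0.
Qed.

Let mass t := \sum_(h : t.-tuple T | stays_above h) p h.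

Let mass_step t :
  mass t - (if (T0 <= t.+1)%N then #|J|%:R * expR (- c) ^+ t.+1 else 0)
  <= mass t.+1.
Proof.
(* Markov's inequality for the exponential moment, summed over [J]. *)
pose viol (h : seq T) : R := if (T0 <= size h)%N then
  \sum_j expR (la * (th * (size h)%:R - \sum_(r <- h) X j r)) else 0.
have violP h : 1 - viol h <= (above h)%:R.
  rewrite /viol /above; case: ifP => hT; last by rewrite subr0; case: forallP.
  case: (boolP [forall _, _]) => [_|/forallPn[j]].
    by rewrite gerBl sumr_ge0 // => j _; exact: expR_ge0.
  rewrite implyTb -leNgt => Sle.
  rewrite subr_le0 (bigD1 j) //= -[leLHS]addr0 lerD //.
    by rewrite -{1}expR0 ler_expR mulr_ge0 // subr_ge0.
  by rewrite sumr_ge0 // => k _; exact: expR_ge0.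
have viol_le : \sum_(h : t.-tuple T | stays_above h) \sum_r
    p (rcons h r) * viol (rcons h r)
    <= if (T0 <= t.+1)%N then #|J|%:R * expR (- c) ^+ t.+1 else 0.
  rewrite /viol; under eq_bigr do under eq_bigr do rewrite size_rcons size_tuple.
  case: ifP => _; last by rewrite big1 // => h _; rewrite big1 // => r _; rewrite mulr0.
  under eq_bigr do under eq_bigr do rewrite mulr_sumr.
  under eq_bigr do rewrite exchange_big /=.
  rewrite exchange_big /= mulr_natl -sumr_const.
  apply: ler_sum => j _.
  under eq_bigr do under eq_bigr do
    rewrite mulrBr expRD mulrCA.
  under eq_bigr do rewrite -mulr_sumr.
  rewrite -mulr_sumr.
  apply: (le_trans (ler_wpM2l (expR_ge0 _) (moment_step t j))).
  apply: (le_trans (ler_wpM2l (expR_ge0 _) (ler_wpM2l (expR_ge0 _) (moment_le t j)))).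
  (* The level contributes [expR (la * th)] once per round and cancels against the drift factor,
     leaving [expR (- c) ^+ t.+1]. *)
  by rewrite -exprS mulrA expRM_natr -exprMn -expRD opprD addrCA subrr addr0.
apply: (le_trans (lerB (lexx _) viol_le)).
rewrite /mass -sumrB [leRHS]big_mkcond.
rewrite (big_tuple_rcons t (fun h => if stays_above h then p h else 0)).
rewrite [leLHS]big_mkcond; apply: ler_sum => h _.
case: ifPn => hok; last by rewrite big1 // => r _; rewrite stays_above_rcons (negbTE hok).
rewrite -p_rcons -sumrB; apply: ler_sum => r _.
rewrite stays_above_rcons hok /=.
have := violP (rcons h r); have := p_ge0 (rcons h r).
by case: above => /=; nra.
Qed.

Lemma stays_above_mass t :
  1 - #|J|%:R * (expR (- c) ^+ T0 / (1 - expR (- c))) <= mass t.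
Proof.
set x := expR (- c).
have x_lt1 : x < 1 by rewrite expR_lt1 oppr_lt0.
have x_ge0 : 0 <= x := expR_ge0 _.
(* The induction keeps the partial geometric sum over the lengths [T0, ..., t]; the [maxn] makes it
   empty while [t < T0], when nothing can be lost. *)
suff H : 1 - #|J|%:R * ((x ^+ T0 - x ^+ maxn T0 t.+1) / (1 - x)) <= mass t.
  apply: le_trans H; rewrite lerB // ler_wpM2l // ler_wpM2r //.
    by rewrite invr_ge0 subr_ge0 ltW.
  by rewrite gerBl exprn_ge0.
elim: t => [|t IHt].
  rewrite (maxn_idPl _) // subrr mul0r mulr0 subr0 /mass.
  rewrite (big_pred1 [tuple]) ?p_nil // => h.
  by rewrite tuple0 stays_above_nil; apply/esym/eqP.
apply: le_trans (mass_step t); apply: le_trans (lerB IHt (lexx _)).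
case: ifP => lt.
  have -> : maxn T0 t.+1 = t.+1 by apply/maxn_idPr.
  have -> : maxn T0 t.+2 = t.+2 by apply/maxn_idPr/leqW.
  have Dx : (1 - x) / (1 - x) = 1 by rewrite mulfV // subr_eq0 gt_eqF.
  rewrite -/x [x ^+ t.+2]exprS.
  have -> : #|J|%:R * x ^+ t.+1 = #|J|%:R * x ^+ t.+1 * ((1 - x) / (1 - x)).
    by rewrite Dx mulr1.
  by rewrite le_eqVlt; apply/orP; left; apply/eqP; ring.
rewrite subr0.
have T0t : (t.+2 <= T0)%N by rewrite ltnNge lt.
by rewrite !(maxn_idPl _) // ltnW.
Qed.
End Deviation.
(** * The best response *)

Fact even_ge2 (n : nat) : (0 < n)%N -> ~~ odd n -> (2 <= n)%N.
Proof. by case: n => [|[|]]. Qed.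

Fact half_le (n : nat) : (n./2 <= n)%N.
Proof. lia. Qed.

(** Because indices start at 0, this bid is exactly half the value for odd [v], and half the value
    plus [1/(2H)] for even [v]. *)
Definition best_bid (H : nat) (v : 'I_H) : 'I_H :=
  Ordinal (leq_ltn_trans (half_le v) (ltn_ord v)).

Section Margins.
Context (R : realType) (H : nat).

Lemma best_bid_in_range (v : 'I_H) :
  grid R v / 2 <= grid R (best_bid v) < grid R v / 2 + 1 / H%:R.
Proof.
have H_gt0 : 0 < H%:R :> R by rewrite ltr0n (leq_ltn_trans _ (ltn_ord v)).
rewrite /grid /= mulrAC -mulrDl ler_pM2r ?ltr_pM2r ?invr_gt0 //.
have : v%:R = (odd v)%:R + 2 * (v./2)%:R :> R.
  by rewrite -[in LHS](odd_double_half v) natrD -mul2n natrM.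
rewrite -[v.+1%:R]natr1 -[v./2.+1%:R]natr1 => vE.
by move: vE; case: (odd v) => /= ->; apply/andP; split; lra.
Qed.

Definition tie_avg (f : bidder -> R) : R := (f true + f false) / 2.

(** The probability that [b] wins against [m] when ties are broken fairly. *)
Definition share (b m : nat) : R := (m < b)%:R + (m == b)%:R / 2.

Lemma utility_avg i (v b m : 'I_H) :
  tie_avg (utility R i v b m) = (v%:R - b%:R) / H%:R * share b m.
Proof.
have H_gt0 : 0 < H%:R :> R by rewrite ltr0n (leq_ltn_trans _ (ltn_ord v)).
rewrite /tie_avg /utility /wins /grid ltr_pM2r ?invr_gt0 // ltr_nat ltnS.
have -> : (m.+1%:R / H%:R == b.+1%:R / H%:R :> R) = (m == b :> nat).
  have Hn0 : H%:R^-1 != 0 :> R by rewrite invr_eq0 gt_eqF.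
  by rewrite (inj_eq (mulIf Hn0)) eqr_nat eqSS.
rewrite /share -[v.+1%:R]natr1 -[b.+1%:R]natr1.
by case: i; case: ltngtP => //= _; rewrite ?mulr0n ?mulr1n; field; rewrite gt_eqF.
Qed.

Lemma sum_share (b n : nat) :
  \sum_(m < n) share b m = if (b < n)%N then b%:R + 1 / 2 else n%:R.
Proof.
elim: n => [|n IHn]; first by rewrite big_ord0.
rewrite big_ord_recr /= IHn /share ltnS.
have [b0 b1] : false%:R = 0 :> R /\ true%:R = 1 :> R by [].
by case: (ltngtP b n) => [_|_|->] /=; rewrite ?b0 ?b1 -?[n.+1%:R]natr1; lra.
Qed.

(** The indices [2k] and [2k + 1] have the same half, and for even [n] these pairs are complete, so
    the sum is twice that of [sum_share] over [n./2] bids. *)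
Lemma sum_share_half (b n : nat) : ~~ odd n ->
  \sum_(m < n) share b m./2 = if (b < n./2)%N then 2 * b%:R + 1 else n%:R.
Proof.
move=> /even_halfK <-; rewrite doubleK; set k := n./2.
suff -> : \sum_(m < k.*2) share b m./2 = 2 * \sum_(m < k) share b m.
  by rewrite sum_share; case: ifP => _; rewrite -?mul2n ?natrM; lra.
elim: k => [|k IHk]; first by rewrite !big_ord0 mulr0.
rewrite doubleS !big_ord_recr /= IHk uphalf_double doubleK; lra.
Qed.

(* The constant 1 in the case [a = best_bid c] makes the bounds below hold for
   all indices. *)
Definition margin (i : bidder) (c a m : 'I_H) (w : bidder) : R :=
  if a == best_bid c then 1
  else utility R i c (best_bid c) m w - utility R i c a m w.

Lemma margin_bounded i c a m w : `|margin i c a m w| <= 1.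
Proof.
rewrite /margin; case: ifP => _; first by rewrite normr1.
have H_gt0 : 0 < H%:R :> R by rewrite ltr0n (leq_ltn_trans _ (ltn_ord c)).
have grid_in (k : 'I_H) : 0 <= grid R k <= 1.
  rewrite /grid divr_ge0 ?ler0n //= ler_pdivrMr // mul1r ler_nat.
  exact: ltn_ord.
move: (grid_in c) (grid_in a) (grid_in (best_bid c)).
rewrite /utility ler_norml => /andP[? ?] /andP[? ?] /andP[? ?].
by case: wins; case: wins; apply/andP; split; lra.
Qed.

Definition mean_margin i c a m : R := tie_avg (margin i c a m).

Lemma mean_margin_bounded i c a m : `|mean_margin i c a m| <= 1.
Proof.
rewrite /mean_margin /tie_avg.
have := margin_bounded i c a m true; have := margin_bounded i c a m false.
rewrite !ler_norml => /andP[? ?] /andP[? ?]; apply/andP; split; lra.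
Qed.

Let mean_marginE i (c a m : 'I_H) : a != best_bid c ->
  mean_margin i c a m =
  (c%:R - (best_bid c)%:R) / H%:R * share (best_bid c) m
  - (c%:R - a%:R) / H%:R * share a m.
Proof.
move=> ne; rewrite -!(utility_avg i) /mean_margin /tie_avg /margin (negbTE ne).
lra.
Qed.

(* [(c - b) (b + 1/2)] is a quadratic in [b] with maximum at [c/2 - 1/4]. *)
Let quadratic_gap (c a : 'I_H) : a != best_bid c ->
  1 / 2 <= (c%:R - (best_bid c)%:R) * ((best_bid c)%:R + 1 / 2)
           - (c%:R - a%:R) * (a%:R + 1 / 2) :> R.
Proof.
rewrite -val_eqE /= => ne.
have -> : c%:R = (odd c)%:R + 2 * (c./2)%:R :> R.
  by rewrite -[in LHS](odd_double_half c) natrD -mul2n natrM.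
set b := c./2 in ne *.
(* With [d = a - b], the gap is [d^2 + d/2] for even [c] and [d^2 - d/2] for odd [c]; both are at
   least [1/2] for a nonzero integer [d]. *)
have : 1 <= b%:R - a%:R :> R \/ 1 <= a%:R - b%:R :> R.
  by case: (ltngtP a b) ne => // lt _; [left|right];
     rewrite lerBrDr nat1r ler_nat.
by case: (odd c) => /= -[]; nra.
Qed.

(** Summed over all opposing bids, the bid [b] has winning weight [b + 1/2], so the sum is the gap
    of [quadratic_gap] divided by [H]. *)
Lemma mean_margin_uniform i (c a : 'I_H) :
  1 / (2 * H%:R) <= \sum_(m < H) mean_margin i c a m.
Proof.
have H_ge1 : 1 <= H%:R :> R by rewrite ler1n (leq_ltn_trans _ (ltn_ord c)).
have H_gt0 : 0 < H%:R :> R by rewrite (lt_le_trans ltr01).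
have [->|ne] := eqVneq a (best_bid c).
  under eq_bigr do rewrite /mean_margin /tie_avg /margin eqxx.
  rewrite sumr_const card_ord -mulr_natl ler_pdivrMr; nra.
under eq_bigr do rewrite mean_marginE //.
rewrite sumrB -!mulr_sumr !sum_share !ltn_ord.
rewrite -[_ / _ * _]mulrAC -[X in _ <= _ - X]mulrAC -mulrBl invfM mulrA.
by rewrite ler_pM2r ?invr_gt0 // quadratic_gap.
Qed.

Lemma mean_margin_best i (c a : 'I_H) : ~~ odd H ->
  1 / H%:R <= \sum_(v < H) mean_margin i c a (best_bid v).
Proof.
move=> H_even.
have H_ge1 : 1 <= H%:R :> R by rewrite ler1n (leq_ltn_trans _ (ltn_ord c)).
have H_gt0 : 0 < H%:R :> R by rewrite (lt_le_trans ltr01).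
have [->|ne] := eqVneq a (best_bid c).
  under eq_bigr do rewrite /mean_margin /tie_avg /margin eqxx.
  rewrite sumr_const card_ord -mulr_natl ler_pdivrMr; nra.
under eq_bigr do rewrite mean_marginE //.
rewrite sumrB -!mulr_sumr !sum_share_half //.
rewrite -[_ / _ * _]mulrAC -[X in _ <= _ - X]mulrAC -mulrBl.
rewrite ler_pM2r ?invr_gt0 //.
have -> : ((best_bid c) < H./2)%N by have := ltn_ord c; rewrite /=; lia.
have := quadratic_gap ne; case: ltnP => [_|le_a]; first lra.
have c_ge : (best_bid c)%:R <= c%:R :> R by rewrite ler_nat half_le.
have b_ge0 : 0 <= (best_bid c)%:R :> R by [].
(* Here [a >= H/2] beats every opposing bid, with weight [H]. If [a <= c], this weight is at most
   [2a + 1] and the quadratic comparison still applies; if [a > c], the bid exceeds the value and is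
   costly, while the best bid never loses money. *)
case: (leqP a c) => [ac|ca].
  have : H%:R <= 2 * a%:R + 1 :> R.
    by rewrite -natrM natr1 ler_nat; lia.
  have : a%:R <= c%:R :> R by rewrite ler_nat.
  nra.
have : c%:R + 1 <= a%:R :> R by rewrite natr1 ler_nat.
nra.
Qed.
End Margins.
(** * The law of the history *)

Section RepeatedAuction.
Context (R : realType) (H : nat) (d : measure_display) (Omega : measurableType d)
  (P : probability Omega R) (dS : measure_display) (S : measurableType dS)
  (X : primitives H Omega S) (X_law : primitives_law P X).

Definition pr (A : set Omega) : R := fine (P A).

Lemma pr_ge0 A : 0 <= pr A.
Proof. by rewrite fine_ge0. Qed.

Lemma pr_le A B : measurable A -> measurable B -> A `<=` B -> pr A <= pr B.
Proof.
move=> mA mB AB; apply: fine_le; rewrite ?fin_num_measure //.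
by apply: le_measure; rewrite ?inE.
Qed.

Lemma pr_partition (T : finType) (f : Omega -> T) (A : set Omega) :
  (forall x, measurable (A `&` [set o | f o = x])) ->
  pr A = \sum_x pr (A `&` [set o | f o = x]).
Proof.
move=> mA; rewrite /pr sum_fine => [|x _]; last by rewrite fin_num_measure.
congr fine; rewrite -big_enum fsbig_seq ?enum_uniq //=.
rewrite -measure_fin_bigcup //.
- congr (P _); apply/seteqP; split=> [ o Ao|o [x _ []] //].
  by exists (f o) => //=; rewrite mem_enum.
- by move=> x y _ _ [ o [[_ /= <-] [_ /= <-]]].
Qed.

Lemma measurable_partition (T : finType) (f : Omega -> T) (D : set T) :
  (forall x, measurable [set o | f o = x]) -> measurable (f @^-1` D).
Proof.
move=> mf; have -> : f @^-1` D = \bigcup_(x in D) [set o | f o = x].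
  apply/seteqP; split => [ o Do|o [x Dx /= fx]]; first by exists (f o).
  by rewrite /= fx.
apply: fin_bigcup_measurable => // x _; exact: mf.
Qed.

(** * Finite cylinders over the primitive sources and their independence *)

Lemma events_ofT k : events_of X k setT.
Proof. by case: k => [i t|i t|t|i]; exists setT => //; rewrite setTI. Qed.

Lemma events_ofI k A B :
  events_of X k A -> events_of X k B -> events_of X k (A `&` B).
Proof.
case: k => [i t|i t|t|i] [A' mA <-] [B' mB <-]; exists (A' `&` B');
  by rewrite ?preimage_setI ?setTI //; exact: measurableI.
Qed.

Definition cylinder (Q : pred source) (A : set Omega) : Prop :=
  exists (s : seq source) (E : source -> set Omega),
    [/\ uniq s, {subset s <= Q}, forall k, events_of X k (E k)
      & A = \bigcap_(k in [set` s]) E k].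

Lemma cylinder_event (Q : pred source) k A : Q k -> events_of X k A -> cylinder Q A.
Proof.
move=> Qk XA; exists [:: k], (fun j => if j == k then A else setT); split => //.
- by move=> j; rewrite inE => /eqP ->.
- move=> j; case: eqP => [->|_] //; exact: events_ofT.
- apply/seteqP; split=> [ o Ao j /=|o /(_ k)/=]; first by case: eqP.
  by rewrite eqxx; apply; rewrite inE.
Qed.

Lemma cylinderI (Q : pred source) A B :
  cylinder Q A -> cylinder Q B -> cylinder Q (A `&` B).
Proof.
move=> [s [E [us sQ XE ->]]] [s' [E' [us' sQ' XE' ->]]].
exists (undup (s ++ s')), (fun k => (if k \in s then E k else setT) `&`
                                 (if k \in s' then E' k else setT)).
split; first exact: undup_uniq.
- by move=> k; rewrite mem_undup mem_cat => /orP[/sQ|/sQ'].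
- by move=> k; apply: events_ofI; case: ifP => _ //; exact: events_ofT.
- apply/seteqP; split => [ o [sE sE'] k /= _|o sEE'].
    by split; case: ifPn => // ks; [exact: sE|exact: sE'].
  by split => k /= ks; have /= := sEE' k; rewrite mem_undup mem_cat ks ?orbT
    => /(_ isT)[].
Qed.

Lemma sub_cylinder (Q Q' : pred source) A :
  {subset Q <= Q'} -> cylinder Q A -> cylinder Q' A.
Proof.
by move=> QQ' [s [E [us sQ XE ->]]]; exists s, E; split => // k /sQ/QQ'.
Qed.

Lemma measurable_cylinder (Q : pred source) A : cylinder Q A -> measurable A.
Proof.
move=> [s [E [_ _ XE ->]]]; apply: fin_bigcap_measurable.
  by apply/finite_seqP; exists s.
by move=> k _; apply: (events_measurable X_law); exact: XE.
Qed.

(** The product formula is used twice, for the sources of [A] and for these together with [k]; the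
    common factors then match. *)
Lemma cylinder_indep (Q : pred source) k A B :
  cylinder Q A -> ~~ Q k -> events_of X k B ->
  pr (A `&` B) = pr A * pr B.
Proof.
move=> cA /negP nQ XB; have mA := measurable_cylinder cA.
have mB : measurable B by exact: (events_measurable X_law XB).
rewrite /pr -fineM ?fin_num_measure //; congr fine.
case: cA => s [E [us sQ XE ->]].
have ks : k \notin s by apply/negP => /sQ.
pose F j := if j == k then B else E j.
have FE j : j \in s -> F j = E j.
  by rewrite /F; case: eqP => // -> ; rewrite (negbTE ks).
have XF j : events_of X j (F j) by rewrite /F; case: eqP => [->|].
have := sources_independent X_law (s := k :: s) (E := F).
rewrite /= ks us => /(_ isT (fun j _ => XF j)).
rewrite big_cons (eq_big_seq (P \o E)) => [|j js] /=; last by rewrite FE.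
rewrite -(sources_independent X_law us (fun j _ => XE j)).
rewrite {2}/F eqxx muleC => <-; congr (P _).
apply/seteqP; split => [ o [sE Bo] j /=|o sF].
  rewrite inE => /orP[/eqP ->|js]; first by rewrite /F eqxx.
  by rewrite FE //; exact: sE.
split; last by have := sF k; rewrite /F eqxx; apply; rewrite /= mem_head.
by move=> j /= js; rewrite -FE //; apply: sF; rewrite /= inE js orbT.
Qed.

Context (T0 : nat) (alg : bidder -> algorithm H S)
  (alg_meas : forall i, measurable_algorithm (alg i)).

Notation history := (history T0 X alg).
Notation bid_after := (bid_after T0 X alg).

(** A seed serves all rounds at once, so it always belongs to the past. Only the values, exploration
    bids and ties of later rounds are fresh. *)
Definition no_later (t : nat) (k : source) : bool :=
  match k with
  | Value _ s | Explore _ s | Tie s => (s <= t)%N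
  | Seed _ => true
  end.

Let sub_no_later_S t : {subset no_later t <= no_later t.+1}.
Proof. by case=> [i s|i s|s|i] //; exact: leqW. Qed.

Lemma cylinder_value (Q : pred source) i t v :
  Q (Value i t) -> cylinder Q [set o | value X i t o = v].
Proof.
by move=> Qv; apply: (cylinder_event Qv); exists [set v] => //; rewrite setTI.
Qed.

Lemma cylinder_tie (Q : pred source) t w :
  Q (Tie t) -> cylinder Q [set o | tie X t o = w].
Proof.
by move=> Qv; apply: (cylinder_event Qv); exists [set w] => //; rewrite setTI.
Qed.

(** Fixing the value together with the bid is essential: for given [h] and [v] the adaptive bid is
    an event of the seed alone, whereas the bid without the value would be a union over values. *)
Lemma cylinder_bid_after (Q : pred source) h i t v b :
  Q (Value i t) -> Q (Explore i t) -> Q (Seed i) ->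
  cylinder Q [set o | value X i t o = v /\ bid_after h i t o = b].
Proof.
move=> QV QE QS.
have [le_t|lt_t] := leqP t T0.
  have -> : [set o | value X i t o = v /\ bid_after h i t o = b] =
      [set o | value X i t o = v] `&` [set o | explore X i t o = b].
    by rewrite /bid_after /Defs.bid_after le_t.
  apply: cylinderI; first exact: cylinder_value.
  by apply: (cylinder_event QE); exists [set b] => //; rewrite setTI.
have -> : [set o | value X i t o = v /\ bid_after h i t o = b] =
    [set o | value X i t o = v] `&` [set o | alg i h v (seed X i o) = b].
  rewrite /Defs.bid_after leqNgt lt_t /=.
  by apply/seteqP; split => o /= [-> ->].
apply: cylinderI; first exact: cylinder_value.
apply: (cylinder_event QS); exists [set s | alg i h v s = b].
  exact: alg_meas.
by rewrite setTI.
Qed.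

Definition current_round (t : nat) (o : Omega) : round H :=
  ([ffun i => value X i t.+1 o], [ffun i => bid_after (history t o) i t.+1 o],
   tie X t.+1 o).

Lemma historyS t o : history t.+1 o = rcons (history t o) (current_round t o).
Proof. by []. Qed.

Lemma size_history t o : size (history t o) = t.
Proof. by elim: t => [|t IHt] //; rewrite historyS size_rcons IHt. Qed.

(* Once the history is fixed, every adaptive bid is an event of one seed, so
   independence of the sources applies. *)
Lemma cylinder_history t h : size h = t ->
  cylinder (no_later t) [set o | history t o = h].
Proof.
elim: t h => [|t IHt] h.
  move=> /size0nil ->.
  apply: (@cylinder_event _ (Seed true)) => //.
  by rewrite (_ : [set _ | _] = setT); [exact: events_ofT|apply/seteqP; split].
case/lastP: h => [|h r] //; rewrite size_rcons => -[size_h].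
have -> : [set o | history t.+1 o = rcons h r] =
    [set o | history t o = h] `&`
    ([set o | value X true t.+1 o = r.1.1 true /\
              bid_after h true t.+1 o = r.1.2 true] `&`
     [set o | value X false t.+1 o = r.1.1 false /\
              bid_after h false t.+1 o = r.1.2 false]) `&`
    [set o | tie X t.+1 o = r.2].
  apply/seteqP; split => o.
    by move=> /= /rcons_inj[-> <-] /=; rewrite !ffunE.
  move=> /= [[ho [[v1 b1] [v2 b2]]] to]; rewrite ho; congr rcons.
  case: r v1 b1 v2 b2 to => -[v b] w /= v1 b1 v2 b2 <-.
  by congr (_, _, _); apply/ffunP => -[]; rewrite ffunE.
apply: cylinderI; last by apply: cylinder_tie; rewrite /= leqnn.
apply: cylinderI.
  by apply: sub_cylinder (IHt h size_h); exact: sub_no_later_S.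
by apply: cylinderI; apply: cylinder_bid_after; rewrite /= ?leqnn.
Qed.

(** * Path probabilities and the joint law of the next value and bid *)

Definition path_prob (h : seq (round H)) : R :=
  pr [set o | history (size h) o = h].

Let measurable_history t h : measurable [set o | history t o = h].
Proof.
have [ht|ht] := eqVneq (size h) t.
  exact: measurable_cylinder (cylinder_history ht).
rewrite (_ : [set _ | _] = set0) //; apply/seteqP; split => // o /= ho.
by move: ht; rewrite -ho size_history eqxx.
Qed.

Let path_rcons h r :
  [set o | history (size h) o = h] `&` [set o | current_round (size h) o = r] =
  [set o | history (size (rcons h r)) o = rcons h r].
Proof.
rewrite size_rcons; apply/seteqP; split => o.
  by move=> [/= ho <-]; congr rcons.
by move=> /(rcons_inj (s1 := history (size h) o) (s2 := current_round (size h) o))[].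
Qed.

Lemma path_prob_ge0 h : 0 <= path_prob h. Proof. exact: pr_ge0. Qed.

Lemma path_prob_nil : path_prob [::] = 1.
Proof.
rewrite /path_prob /= (_ : [set _ | _] = setT); last by apply/seteqP; split.
by rewrite /pr probability_setT.
Qed.

Lemma path_prob_rcons h : \sum_r path_prob (rcons h r) = path_prob h.
Proof.
rewrite [RHS](pr_partition (f := current_round (size h))) => [|r].
  by apply: eq_bigr => r _; rewrite path_rcons.
by rewrite path_rcons.
Qed.

Lemma sum_path_prob t : \sum_(h : t.-tuple (round H)) path_prob h = 1.
Proof.
elim: t => [|t IHt].
  rewrite (big_pred1 [tuple]) ?path_prob_nil // => h.
  by apply/esym/eqP; exact: tuple0.
by rewrite big_tuple_rcons -[RHS]IHt; apply: eq_bigr => h _; exact: path_prob_rcons.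
Qed.

(** Change of variables: a sum over whole rounds reduces to the law of the part [f] of the round on
    which the summand depends. *)
Lemma sum_path_round (Y : finType) (f : round H -> Y) (g : Y -> R) h :
  \sum_r path_prob (rcons h r) * g (f r) =
  \sum_y g y * pr ([set o | history (size h) o = h] `&`
                   [set o | f (current_round (size h) o) = y]).
Proof.
rewrite (partition_big f predT) //=; apply: eq_bigr => y _.
rewrite (eq_bigr (fun r => g y * path_prob (rcons h r))) => [|r /eqP <-]; last first.
  exact: mulrC.
rewrite -mulr_sumr; congr (_ * _).
have key r : [set o | history (size h) o = h] `&`
       [set o | f (current_round (size h) o) = y] `&`
       [set o | current_round (size h) o = r] =
     if f r == y then [set o | history (size (rcons h r)) o = rcons h r] else set0.
  rewrite -path_rcons; case: eqP => fr; apply/seteqP; split => o //=.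
  - by case=> -[].
  - by case=> -> ->.
  - by case=> -[_ fy] rE; case: fr; rewrite -rE.
rewrite [RHS](pr_partition (f := current_round (size h))) => [|r].
  rewrite big_mkcond; apply: eq_bigr => r _; rewrite key.
  by case: eqP => // _; rewrite /pr measure0.
by rewrite key; case: eqP.
Qed.

(** A joint rather than conditional probability, so that histories of mass zero need no separate
    treatment. *)
Definition play_prob (h : seq (round H)) (j : bidder) (c m : 'I_H) : R :=
  let t := (size h).+1 in
  pr ([set o | history (size h) o = h] `&`
      [set o | value X j t o = c /\ bid_after h j t o = m]).

Lemma play_prob_ge0 h j c m : 0 <= play_prob h j c m.
Proof. exact: pr_ge0. Qed.

Let pr_value i t v : (0 < t)%N -> pr [set o | value X i t o = v] = H%:R^-1.
Proof.
move=> t_gt0; rewrite /pr; have := value_uniform X_law i v t_gt0.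
by rewrite /preimage /= => ->.
Qed.

Let event_value i t v : events_of X (Value i t) [set o | value X i t o = v].
Proof. by exists [set v] => //; rewrite setTI. Qed.

Let history_value h i c :
  pr ([set o | history (size h) o = h] `&` [set o | value X i (size h).+1 o = c])
  = path_prob h / H%:R.
Proof.
rewrite (cylinder_indep (cylinder_history erefl) (k := Value i (size h).+1)) //.
  by rewrite pr_value.
by rewrite /= ltnn.
Qed.

Lemma sum_play_prob h j c : \sum_m play_prob h j c m = path_prob h / H%:R.
Proof.
rewrite -(history_value h j c).
rewrite [RHS](pr_partition (f := bid_after h j (size h).+1)) => [|m].
  apply: eq_bigr => m _; congr pr; rewrite -setIA; congr (_ `&` _).
rewrite -setIA; apply: (@measurable_cylinder (no_later (size h).+1)).
apply: cylinderI; first exact: sub_cylinder (cylinder_history erefl).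
by apply: cylinder_bid_after; rewrite /= ?leqnn.
Qed.

Lemma play_prob_explore h j c m : (size h < T0)%N ->
  play_prob h j c m = path_prob h / H%:R / H%:R.
Proof.
move=> lt_h; rewrite /play_prob.
set t := (size h).+1.
have -> : [set o | value X j t o = c /\ bid_after h j t o = m] =
  [set o | value X j t o = c] `&` [set o | explore X j t o = m].
  by rewrite /Defs.bid_after lt_h.
rewrite setIA.
(* The next value joins the past, so that the exploration bid and then the value can be split off
   one at a time. *)
pose Q : pred source := [pred k | no_later (size h) k || (k == Value j t)].
rewrite (@cylinder_indep Q (Explore j t)).
- rewrite history_value; congr (_ * _).
  rewrite /pr; have := explore_uniform X_law j m (ltn0Sn (size h)).
  by rewrite /preimage /= => ->.
- apply: cylinderI.
    apply: sub_cylinder (cylinder_history erefl) => k kh.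
    by apply/orP; left.
  by apply: cylinder_value; apply/orP; right; exact/eqP.
- by apply/negP => /orP[|/eqP//]; rewrite /= ltnn.
- by exists [set m] => //; rewrite setTI.
Qed.

(** The tie-break is the only fresh source beyond value and bid; it contributes the factor [1/2]
    that later becomes [tie_avg]. *)
Lemma play_prob_tie h j c m w : let t := (size h).+1 in
  pr ([set o | history (size h) o = h] `&`
      [set o | ((current_round (size h) o).1.1 j,
                (current_round (size h) o).1.2 j,
                (current_round (size h) o).2) = (c, m, w)])
  = play_prob h j c m / 2.
Proof.
move=> t.
pose Q : pred source :=
  [pred k | no_later (size h) k || (k == Value j t) || (k == Explore j t)].
have -> : 2^-1 = pr [set o | tie X t o = w].
  rewrite /pr; have := tie_uniform X_law w (ltn0Sn (size h)).
  by rewrite /preimage /= => ->.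
rewrite -(@cylinder_indep Q (Tie t)).
- congr pr; apply/seteqP; split => o /=; rewrite !ffunE.
    by case=> ho [<- <- <-]; rewrite ho.
  by case=> -[ho [<- <- <-]]; rewrite ho.
- apply: cylinderI.
    apply: sub_cylinder (cylinder_history erefl) => k kh.
    by apply/orP; left; apply/orP; left.
  apply: cylinder_bid_after => //.
    by apply/orP; left; apply/orP; right; exact/eqP.
  by apply/orP; right; exact/eqP.
- by apply/negP => /orP[/orP[|/eqP//]|/eqP//]; rewrite /= ltnn.
- by exists [set w] => //; rewrite setTI.
Qed.

Lemma play_prob_mean_based (gamma : nat -> R) h j c a b :
  mean_based P T0 X alg gamma j -> (T0 <= size h)%N ->
  cumulative_reward R j a c h <
    cumulative_reward R j b c h - gamma (size h) * (size h)%:R ->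
  play_prob h j c a <= gamma (size h) * (path_prob h / H%:R).
Proof.
move=> mb le_h lt_ab.
pose past := [set o | history (size h) o = h /\ value X j (size h).+1 o = c].
have mpast : measurable past.
  apply: (@measurable_cylinder (no_later (size h).+1)).
  apply: cylinderI; first exact: sub_cylinder (cylinder_history erefl).
  by apply: cylinder_value; rewrite /= leqnn.
pose played := [set o | value X j (size h).+1 o = c /\
                        bid_after h j (size h).+1 o = a].
have playE : [set o | history (size h) o = h] `&` played =
    [set o | bid T0 X alg j (size h).+1 o = a] `&` past.
  apply/seteqP; split => o; rewrite /played /past /bid /=.
    by move=> [ho [vo bo]]; rewrite ho.
  by move=> [bo [ho vo]]; move: bo; rewrite ho.
have mplay : measurable ([set o | history (size h) o = h] `&` played).
  apply: (@measurable_cylinder (no_later (size h).+1)).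
  apply: cylinderI; first exact: sub_cylinder (cylinder_history erefl).
  by apply: cylinder_bid_after; rewrite /= ?leqnn.
have pastE : pr past = path_prob h / H%:R := history_value h j c.
rewrite -pastE /play_prob -/played playE.
rewrite playE in mplay.
(* [mean_based] says nothing about a past of mass zero, but there both sides vanish. *)
have [past_gt0|past_le0] := ltP 0%E (P past); last first.
  have past0 : pr past = 0.
    by apply/eqP; rewrite eq_le pr_ge0 andbT /pr fine_le0.
  rewrite past0 mulr0 -past0; exact: pr_le.
have := mb (size h) h c a b le_h past_gt0 lt_ab.
rewrite /cond_prob ler_pdivrMr // fine_gt0 // past_gt0 /=.
by rewrite -ge0_fin_numE ?fin_num_measure.
Qed.

(** * Persistence of the margins *)

Context (gamma : nat -> R) (H_gt0 : (0 < H)%N) (H_even : ~~ odd H)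
  (T0_gt0 : (0 < T0)%N)
  (alg_mean_based : forall i, mean_based P T0 X alg gamma i)
  (gamma_small : forall t, (T0 <= t)%N -> gamma t <= 1 / (4 * H%:R ^+ 3)).

(** [threshold] is the assumed bound on [gamma], so a margin above [threshold * t] triggers the
    mean-based property. [tilt] and [rate] are the parameters [la] and [c] of the deviation
    bound. *)
Let threshold : R := 1 / (4 * H%:R ^+ 3).
Let tilt : R := 1 / (16 * H%:R ^+ 2).
Let rate : R := 1 / (64 * H%:R ^+ 4).

Let H_ge2 : 2 <= H%:R :> R.
Proof. by rewrite ler_nat even_ge2. Qed.

Let H_gt0R : 0 < H%:R :> R. Proof. by rewrite ltr0n. Qed.

Definition round_margin (j : bidder * 'I_H * 'I_H) (r : round H) : R :=
  margin R j.1.1 j.1.2 j.2 (r.1.2 (~~ j.1.1)) r.2.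

Notation converged := (stays_above round_margin T0 threshold).

(** The cumulative margin exceeds [threshold * t], hence [gamma t * t], so the mean-based property
    applies with [best_bid c] as the better action. *)
Lemma converged_play h j c a : converged h -> (T0 <= size h)%N ->
  a != best_bid c -> play_prob h j c a <= gamma (size h) * (path_prob h / H%:R).
Proof.
move=> conv le_h ne.
apply: (play_prob_mean_based (b := best_bid c) (@alg_mean_based j)) => //.
have := stays_above_margin (j, c, a) conv le_h.
rewrite (eq_bigr (fun r => reward R j (best_bid c) c r - reward R j a c r)).
  rewrite sumrB -!/(cumulative_reward _ _ _ _ _).
  have : gamma (size h) * (size h)%:R <= threshold * (size h)%:R.
    by rewrite ler_wpM2r // gamma_small.
  lra.
by move=> r _; rewrite /round_margin /margin (negbTE ne).
Qed.

(** For negative [gamma t] the mean-based condition holds even between an action and itself, and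
    would bound a probability by a negative number; summing over histories ensures that the total
    mass is positive. *)
Lemma gamma_ge0 t : (T0 <= t)%N -> 0 <= gamma t.
Proof.
move=> le_t; rewrite leNgt; apply/negP => gamma_lt0.
have t_gt0 : (0 < t)%N := leq_trans T0_gt0 le_t.
pose v : 'I_H := Ordinal H_gt0.
have le0 (h : t.-tuple (round H)) : 0 <= gamma t * (path_prob h / H%:R).
  apply: le_trans (play_prob_ge0 h true v v) _.
  have := @play_prob_mean_based gamma h true v v v (@alg_mean_based true).
  rewrite size_tuple => -> //.
  by rewrite ltrBrDl gtrDr nmulr_rlt0 // ltr0n.
have : 0 <= \sum_(h : t.-tuple (round H)) gamma t * (path_prob h / H%:R).
  by apply: sumr_ge0 => h _.
rewrite -mulr_sumr -mulr_suml sum_path_prob mul1r nmulr_rge0 // leNgt.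
by rewrite invr_gt0 H_gt0R.
Qed.

Lemma converged_best h i v : converged h -> (T0 <= size h)%N ->
  path_prob h / H%:R * (1 - (H%:R - 1) * gamma (size h))
  <= play_prob h i v (best_bid v).
Proof.
move=> conv le_h.
have := sum_play_prob h i v; rewrite (bigD1 (best_bid v)) //=.
have : \sum_(m | m != best_bid v) play_prob h i v m <=
       \sum_(m | m != best_bid v) gamma (size h) * (path_prob h / H%:R).
  by apply: ler_sum => m ne; exact: converged_play.
have H1 : H.-1%:R = H%:R - 1 :> R by rewrite -subn1 natrB.
rewrite sumr_const cardC1 card_ord -[_ *+ H.-1]mulr_natl H1.
lra.
Qed.

(** Exploration gives this drift directly from [mean_margin_uniform]. Afterwards [mean_margin_best]
    gives twice as much, and half of it is given up to the opponent's deviations from [best_bid]. *)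
Lemma mean_drift h i c a : converged h ->
  1 / (2 * H%:R ^+ 2) * path_prob h <=
  \sum_c' \sum_m play_prob h (~~ i) c' m * mean_margin R i c a m.
Proof.
move=> conv; have p_ge0 := path_prob_ge0 h.
have Hn0 : H%:R != 0 :> R by rewrite gt_eqF.
have [lt_h|le_h] := ltnP (size h) T0.
  under eq_bigr do under eq_bigr do rewrite play_prob_explore //.
  under eq_bigr do rewrite -mulr_sumr.
  rewrite sumr_const card_ord -[leRHS]mulr_natl.
  have := mean_margin_uniform R i c a; set sm := \sum_(m < H) _ => le_sm.
  have -> : H%:R * (path_prob h / H%:R / H%:R * sm) = path_prob h / H%:R * sm.
    by field.
  have -> : 1 / (2 * H%:R ^+ 2) * path_prob h =
      path_prob h / H%:R * (1 / (2 * H%:R)) by field.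
  by rewrite ler_wpM2l // divr_ge0.
pose x := path_prob h / H%:R.
have x_ge0 : 0 <= x by rewrite divr_ge0.
(* A deviating bid has mass at most [x / (4 H^3)] and changes the mean margin by at most 2; over at
   most [H] such bids the loss is [x / (2 H^2)]. *)
have step c' : x * (mean_margin R i c a (best_bid c') - 1 / (2 * H%:R ^+ 2)) <=
    \sum_m play_prob h (~~ i) c' m * mean_margin R i c a m.
  have -> : x * (mean_margin R i c a (best_bid c') - 1 / (2 * H%:R ^+ 2)) =
    \sum_m (play_prob h (~~ i) c' m * mean_margin R i c a (best_bid c')
            - x * (1 / (2 * H%:R ^+ 3))).
    rewrite sumrB -mulr_suml sum_play_prob -/x sumr_const card_ord.
    rewrite -[(x * _) *+ H]mulr_natl.
    by field.
  apply: ler_sum => m _.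
  have y_ge0 : 0 <= x * (1 / (2 * H%:R ^+ 3)).
    by rewrite mulr_ge0 // divr_ge0 // mulr_ge0 // exprn_ge0.
  have [->|ne] := eqVneq m (best_bid c'); first by rewrite gerBl.
  have := converged_play (~~ i) conv le_h ne; rewrite -/x => le_play.
  have le_x : play_prob h (~~ i) c' m <= x * (1 / (4 * H%:R ^+ 3)).
    by apply: le_trans le_play _; rewrite mulrC ler_wpM2l // gamma_small.
  have play_ge0 := play_prob_ge0 h (~~ i) c' m.
  have := mean_margin_bounded R i c a m.
  have := mean_margin_bounded R i c a (best_bid c').
  rewrite !ler_norml => /andP[? ?] /andP[? ?].
  have -> : x * (1 / (2 * H%:R ^+ 3)) = 2 * (x * (1 / (4 * H%:R ^+ 3))).
    by field.
  nra.
apply: (@le_trans _ _ (\sum_c' x * (mean_margin R i c a (best_bid c')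
                                    - 1 / (2 * H%:R ^+ 2)))); last first.
  by apply: ler_sum => c' _; exact: step.
rewrite -mulr_sumr sumrB sumr_const card_ord -[(1 / _) *+ H]mulr_natl.
have -> : 1 / (2 * H%:R ^+ 2) * path_prob h =
    x * (1 / H%:R - H%:R * (1 / (2 * H%:R ^+ 2))).
  by rewrite /x; field.
by rewrite ler_wpM2l // lerB // mean_margin_best.
Qed.

Let expRN_le_quadratic (x : R) : `|x| <= 1 / 2 ->
  expR (- x) <= 1 - x + 2 * x ^+ 2.
Proof.
rewrite ler_norml => /andP[lo hi].
have x1_gt0 : 0 < 1 + x by lra.
rewrite expRN; apply: (@le_trans _ _ (1 + x)^-1).
  by rewrite lef_pV2 ?posrE ?expR_gt0 // expR_ge1Dx.
rewrite -div1r ler_pdivrMr //.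
(* The product [(1 - x + 2 x^2)(1 + x)] equals [1 + x^2 (1 + 2 x)]. *)
have : 0 <= x ^+ 2 * (1 + 2 * x) by rewrite mulr_ge0 ?sqr_ge0 //; lra.
lra.
Qed.

(* [e^-x <= 1 - x + 2 x^2] pointwise, then [mean_drift]; the choice of [tilt]
   leaves [rate]. *)
Lemma converged_drift h (j : bidder * 'I_H * 'I_H) : converged h ->
  \sum_r path_prob (rcons h r) * expR (- (tilt * round_margin j r))
  <= expR (- (rate + tilt * threshold)) * path_prob h.
Proof.
case: j => -[i c] a conv; rewrite /round_margin /=.
pose f (r : round H) := (r.1.1 (~~ i), r.1.2 (~~ i), r.2).
pose g (y : 'I_H * 'I_H * bidder) := expR (- (tilt * margin R i c a y.1.2 y.2)).
rewrite (sum_path_round f g).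
have -> : \sum_y g y * pr ([set o | history (size h) o = h] `&`
      [set o | f (current_round (size h) o) = y]) =
    \sum_c' \sum_m play_prob h (~~ i) c' m *
      tie_avg (fun w => expR (- (tilt * margin R i c a m w))).
  have split3 (F : 'I_H * 'I_H * bidder -> R) :
      \sum_y F y = \sum_c' \sum_m \sum_w F (c', m, w).
    rewrite [RHS]pair_big [RHS]pair_big /=.
    by apply: eq_bigr => -[[c' m] w].
  rewrite split3; apply: eq_bigr => c' _; apply: eq_bigr => m _.
  rewrite big_bool !play_prob_tie /tie_avg /g /=.
  by ring.
have tilt_ge0 : 0 <= tilt by rewrite divr_ge0 // mulr_ge0 // exprn_ge0.
have tilt_le : tilt <= 1 / 2.
  have Hsq : 4 <= H%:R ^+ 2 :> R.
    have -> : 4 = 2 ^+ 2 :> R by ring.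
    by rewrite lerXn2r // nnegrE.
  by rewrite /tilt ler_pdivrMr ?mulr_gt0 ?exprn_gt0 //; lra.
apply: (@le_trans _ _ (\sum_c' \sum_m
  (play_prob h (~~ i) c' m * (1 + 2 * tilt ^+ 2)
   - tilt * (play_prob h (~~ i) c' m * mean_margin R i c a m)))).
  apply: ler_sum => c' _; apply: ler_sum => m _.
  rewrite [tilt * (_ * _)]mulrCA -mulrBr ler_wpM2l ?play_prob_ge0 //.
  have key w : expR (- (tilt * margin R i c a m w)) <=
      1 - tilt * margin R i c a m w + 2 * tilt ^+ 2.
    have := margin_bounded R i c a m w.
    rewrite ler_norml => /andP[lo hi].
    apply: le_trans (expRN_le_quadratic _) _; first by rewrite ler_norml; nra.
    have y2 : margin R i c a m w ^+ 2 <= 1 by nra.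
    have := ler_piMr (sqr_ge0 tilt) y2; rewrite -[X in X <= _]exprMn; lra.
  by rewrite /mean_margin /tie_avg; have := key true; have := key false; lra.
under eq_bigr do rewrite sumrB -mulr_suml sum_play_prob -mulr_sumr.
rewrite sumrB sumr_const card_ord -[(_ * _) *+ H]mulr_natl -mulr_sumr.
have -> : H%:R * (path_prob h / H%:R * (1 + 2 * tilt ^+ 2)) =
    path_prob h * (1 + 2 * tilt ^+ 2) by field; rewrite gt_eqF.
apply: (@le_trans _ _
  ((1 + (2 * tilt ^+ 2 - tilt * (1 / (2 * H%:R ^+ 2)))) * path_prob h)).
  by have := ler_wpM2l tilt_ge0 (mean_drift i c a conv); nra.
rewrite ler_wpM2r ?path_prob_ge0 //; apply: le_trans (expR_ge1Dx _) _.
rewrite ler_expR.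
pose x : R := H%:R^-1.
have x_gt0 : 0 < x by rewrite invr_gt0.
have x_le : x <= 1 / 2 by rewrite div1r lef_pV2 ?posrE.
have -> : tilt = x ^+ 2 / 16 by rewrite /tilt /x; field; rewrite gt_eqF.
have -> : rate = x ^+ 4 / 64 by rewrite /rate /x; field; rewrite gt_eqF.
have -> : threshold = x ^+ 3 / 4 by rewrite /threshold /x; field; rewrite gt_eqF.
have -> : 1 / (2 * H%:R ^+ 2) = x ^+ 2 / 2 by rewrite /x; field; rewrite gt_eqF.
(* The exponent available is [- 3 x^4 / 128], and [rate + tilt * threshold] is
   [x^4 / 64 + x^5 / 64]; they balance exactly at [x = 1/2], that is [H = 2]. *)
have : x ^+ 4 * x <= x ^+ 4 * (1 / 2) by rewrite ler_wpM2l // exprn_ge0 // ltW.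
lra.
Qed.

(** There are [2 H^2] margins, one for each bidder, value and competing bid; the quotient is the
    geometric tail from [T0]. *)
Let error : R :=
  2 * H%:R ^+ 2 * (expR (- rate) ^+ T0 / (1 - expR (- rate))).

Lemma converged_mass t :
  1 - error <= \sum_(h : t.-tuple (round H) | converged h) path_prob h.
Proof.
have := stays_above_mass (p := path_prob) (X := round_margin) (th := threshold)
  (la := tilt) (c := rate) T0_gt0.
have -> : #|{: bidder * 'I_H * 'I_H}|%:R = 2 * H%:R ^+ 2 :> R.
  by rewrite !card_prod card_bool card_ord !natrM expr2 mulrA.
apply.
- by rewrite divr_ge0 // mulr_ge0 // exprn_ge0.
- by rewrite divr_gt0 // mulr_gt0 // exprn_gt0.
- exact: path_prob_ge0.
- exact: path_prob_nil.
- exact: path_prob_rcons.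
- by move=> h j; exact: converged_drift.
Qed.

(** Histories of length [t.+1] form a finite type, so an event on the last round is a finite union
    of history events. *)
Let measurable_current_round t r : measurable [set o | current_round t o = r].
Proof.
pose f o : t.+1.-tuple (round H) := Tuple (introT eqP (size_history t.+1 o)).
have -> : [set o | current_round t o = r] =
    f @^-1` [set h | exists h', val h = rcons h' r].
  apply/seteqP; split => o /=; first by move=> <-; exists (history t o).
  by move=> [h' /(rcons_inj (s1 := history t o) (s2 := current_round t o))[]].
apply: measurable_partition => h.
rewrite (_ : [set o | _] = [set o | history t.+1 o = val h]) //.
by apply/seteqP; split => o /= => [<-|] // fh; exact: val_inj.
Qed.

(** Only converged histories are counted: [converged_best] applies to each, and their total mass is
    at least [1 - error]. *)
Lemma best_bid_prob t i v : (T0 <= t)%N ->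
  (1 - (H%:R - 1) * gamma t) * (1 - error) <=
  cond_prob P [set o | grid R v / 2 <= grid R (bid T0 X alg i t.+1 o)
                               < grid R v / 2 + 1 / H%:R]
              [set o | value X i t.+1 o = v].
Proof.
move=> le_t; set good := [set o | is_true (_ && _)].
set val_v := [set o | value X i t.+1 o = v].
rewrite /cond_prob -!/(pr _) pr_value // invrK.
rewrite -ler_pdivrMr //.
pose best := [set o | value X i t.+1 o = v /\ bid T0 X alg i t.+1 o = best_bid v].
have mround (D : set (round H)) : measurable (current_round t @^-1` D).
  exact: measurable_partition.
have le_best : pr best <= pr (good `&` val_v).
  apply: pr_le.
  - rewrite (_ : best = current_round t @^-1`
      [set r : round H | r.1.1 i = v /\ r.1.2 i = best_bid v]) //.
    by apply/seteqP; split => o; rewrite /best /bid /= !ffunE.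
  - rewrite (_ : good `&` val_v = current_round t @^-1`
      [set r : round H | grid R v / 2 <= grid R (r.1.2 i) < grid R v / 2 + 1 / H%:R
               /\ r.1.1 i = v]) //.
    by apply/seteqP; split => o; rewrite /good /val_v /bid /= !ffunE.
  - move=> o [vo bo]; split => //; rewrite /good /= bo.
    exact: best_bid_in_range.
apply: le_trans le_best.
pose f o : t.-tuple (round H) := Tuple (introT eqP (size_history t o)).
have bestI (h : t.-tuple (round H)) : best `&` [set o | f o = h] =
    [set o | history (size h) o = h] `&`
    [set o | value X i (size h).+1 o = v /\
             bid_after h i (size h).+1 o = best_bid v].
  rewrite size_tuple; apply/seteqP; split => o /=.
    by move=> [[vo bo] <-]; split.
  move=> [ho [vo bo]]; split; last exact: val_inj.
  by split => //; rewrite /bid /= ho.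
rewrite (pr_partition (f := f)) => [|h]; last first.
  rewrite bestI; apply: (@measurable_cylinder (no_later (size h).+1)).
  apply: cylinderI; first exact: sub_cylinder (cylinder_history erefl).
  by apply: cylinder_bid_after; rewrite /= ?leqnn.
rewrite (bigID (fun h : t.-tuple (round H) => converged h)) /=.
rewrite -[leLHS]addr0 lerD //; last by apply: sumr_ge0 => h _; exact: pr_ge0.
apply: (@le_trans _ _ (\sum_(h : t.-tuple (round H) | converged h)
    path_prob h / H%:R * (1 - (H%:R - 1) * gamma t))).
  rewrite -!mulr_suml [leRHS]mulrAC ler_wpM2r ?invr_ge0 //.
  rewrite [leLHS]mulrC ler_wpM2r ?converged_mass // subr_ge0.
  (* The factor [1 - (H - 1) * gamma t] must be nonnegative before the mass bound can be multiplied
     by it. *)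
  have := gamma_small le_t.
  rewrite ler_pdivlMr ?mulr_gt0 ?exprn_gt0 // => /(le_trans _); apply.
  rewrite mulrC ler_wpM2l ?gamma_ge0 //.
  have : H%:R <= H%:R ^+ 3 :> R by rewrite ler_eXnr // ler1n.
  have := H_gt0R; lra.
apply: ler_sum => h conv; rewrite bestI.
have := @converged_best h i v conv; rewrite size_tuple => /(_ le_t).
by rewrite /play_prob size_tuple.
Qed.

End RepeatedAuction.

(** * Comparison of the rates *)

Section Rates.
Context (R : realType).

(* [c'] is the rate of the theorem; the slack [8 c' <= c] between it and the
   rate [c] of the deviation bound absorbs the number of margins and the
   geometric series. *)
Lemma error_bound (H T0 t : nat) (B : R) : (2 <= H)%N -> (0 < T0)%N ->
  (T0 < t)%N ->
  let c : R := 1 / (64 * H%:R ^+ 4) in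
  let c' : R := (H%:R - 1) / (32 * (4 * H%:R ^+ 3 + 1) * H%:R ^+ 4) in
  expR (- ((H%:R - 1) * T0%:R / (32 * (4 * H%:R ^+ 3 + 1) * H%:R ^+ 4)))
    * (ln t%:R / ln ((4 * H%:R ^+ 3 + H%:R) / (4 * H%:R ^+ 3 + 1))) = B ->
  B < 1 ->
  (H <= t)%N /\
  2 * H%:R ^+ 2 * (expR (- c) ^+ T0 / (1 - expR (- c))) <= B.
Proof.
move=> H_ge2 T0_gt0 lt_t c c' BE B_lt1.
have x_ge2 : 2 <= H%:R :> R by rewrite ler_nat.
set x : R := H%:R in x_ge2 c c' BE *.
have x_gt0 : 0 < x by lra.
have x2_ge : 2 * x <= x ^+ 2 by nra.
have x3_ge : 2 * x ^+ 2 <= x ^+ 3 by rewrite exprS; nra.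
have x4_ge : 2 * x ^+ 3 <= x ^+ 4 by rewrite exprS; nra.
pose q : R := expR (- (c' * T0%:R)).
have qE : expR (- ((x - 1) * T0%:R / (32 * (4 * x ^+ 3 + 1) * x ^+ 4))) = q.
  by rewrite /q /c' mulrAC.
rewrite qE in BE.
have q_gt0 : 0 < q := expR_gt0 _.
pose y := 2 * x ^+ 2.
have y_ge8 : 8 <= y by rewrite /y; lra.
have ratio_gt1 : 1 < (4 * x ^+ 3 + x) / (4 * x ^+ 3 + 1).
  by rewrite ltr_pdivlMr; lra.
have lnr_gt0 : 0 < ln ((4 * x ^+ 3 + x) / (4 * x ^+ 3 + 1)) by rewrite ln_gt0.
have lnr_le : ln ((4 * x ^+ 3 + x) / (4 * x ^+ 3 + 1)) <= 1 / (4 * x ^+ 2).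
  have d_gt0 : 0 < 4 * x ^+ 3 + 1 by lra.
  have -> : (4 * x ^+ 3 + x) / (4 * x ^+ 3 + 1) = 1 + (x - 1) / (4 * x ^+ 3 + 1).
    by field; rewrite gt_eqF.
  have k_ge0 : 0 <= (x - 1) / (4 * x ^+ 3 + 1) by rewrite divr_ge0; lra.
  apply: le_trans (le_ln1Dx _) _; first lra.
  rewrite ler_pdivrMr // mulrAC ler_pdivlMr; last by lra.
  rewrite exprS; nra.
(* Since [t >= 2], it suffices that [ln 2 >= 1/2], which is [ln (1 - 1/2) <= - 1/2]. *)
have lnt_ge : 1 / 2 <= ln t%:R :> R.
  have le2t : 2 <= t%:R :> R by rewrite ler_nat (leq_ltn_trans T0_gt0).
  apply: (@le_trans _ _ (ln 2)); last by rewrite ler_ln ?posrE //; lra.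
  have l2 : ln 2 = - ln (2^-1) :> R by rewrite lnV ?posrE // opprK.
  have hE : 2^-1 = 1 + - (1 / 2) :> R by lra.
  have : ln (1 + - (1 / 2)) <= - (1 / 2) :> R by apply: le_ln1Dx; lra.
  rewrite -hE l2; lra.
(* The quotient of logarithms is at least [(1/2) (4 x^2) = y], which is also the number of
   margins. *)
have qy_le : q * y <= B.
  rewrite -BE ler_wpM2l //; first exact: ltW.
  rewrite ler_pdivlMr // /y.
  apply: le_trans lnt_ge.
  apply: (@le_trans _ _ (2 * x ^+ 2 * (1 / (4 * x ^+ 2)))).
    by rewrite ler_wpM2l //; lra.
  by rewrite le_eqVlt; apply/orP; left; apply/eqP; field; rewrite gt_eqF.
have qy_lt1 : q * y < 1 by lra.
have c_gt0 : 0 < c by rewrite divr_gt0 //; lra.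
have cc' : 8 * c' <= c.
  rewrite /c' /c mulrA ler_pdivrMr; last by rewrite mulr_gt0 //; lra.
  have -> : 1 / (64 * x ^+ 4) * (32 * (4 * x ^+ 3 + 1) * x ^+ 4) =
      (4 * x ^+ 3 + 1) / 2 by field; rewrite gt_eqF.
  nra.
have c'_ge0 : 0 <= c' by rewrite divr_ge0 // ?mulr_ge0 ?exprn_ge0 //; lra.
split.
  (* If [t < H], then [T0 < H] makes the exponent small, so [q >= 1/2] and [q * y >= 4], against
     [B < 1]. *)
  rewrite leqNgt; apply/negP => lt_tH.
  have T0_le : T0%:R <= x by rewrite /x ler_nat (leq_trans (ltnW lt_t)) // ltnW.
  have c'T0 : c' * T0%:R <= 1 / 2.
    have : c <= 1 / (64 * x).
      rewrite /c !div1r lef_pV2 ?posrE; lra.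
    have -> : 1 / (64 * x) = (1 / 64) / x by field; rewrite gt_eqF.
    rewrite ler_pdivlMr // => cx.
    have : c' * T0%:R <= c' * x by rewrite ler_wpM2l.
    nra.
  have := expR_ge1Dx (- (c' * T0%:R)); rewrite -/q => q_ge.
  nra.
have y_gt0 : 0 < y by lra.
have eT0 : expR (- c) ^+ T0 <= q ^+ 8.
  rewrite /q -!expRM_natr ler_expR.
  have T0_ge0 : 0 <= T0%:R :> R by [].
  nra.
have e_lt : c / 2 <= 1 - expR (- c).
  have c_le1 : c <= 1 by rewrite /c ler_pdivrMr; lra.
  have e1 : expR (- c) <= (1 + c)^-1.
    by rewrite expRN lef_pV2 ?posrE ?expR_gt0 ?expR_ge1Dx //; lra.
  have : (1 + c)^-1 <= 1 - c / 2.
    rewrite -div1r ler_pdivrMr; nra.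
  lra.
apply: le_trans qy_le.
rewrite -/y [leRHS]mulrC ler_wpM2l //; first exact: ltW.
have cE : c / 2 = 1 / (32 * y ^+ 2).
  by rewrite /c /y; field; rewrite gt_eqF.
rewrite cE in e_lt.
rewrite ler_pdivrMr; last first.
  by apply: lt_le_trans e_lt; rewrite divr_gt0 // mulr_gt0 // exprn_gt0.
apply: le_trans eT0 _; rewrite exprS.
rewrite ler_wpM2l //; first exact: ltW.
apply: le_trans e_lt.
rewrite ler_pdivlMr ?mulr_gt0 ?exprn_gt0 //.
(* One factor [q] was kept for the final bound [q * y]; of the other seven, two absorb [y ^+ 2] and
   five, each at most [1/8], absorb the constant 32. *)
have -> : q ^+ 7 * (32 * y ^+ 2) = (q * y) ^+ 2 * (32 * q ^+ 5) by ring.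
have q_le : q <= 1 / 8 by rewrite ler_pdivlMr //; nra.
have q5 : q ^+ 5 <= (1 / 8) ^+ 5 by rewrite lerXn2r ?nnegrE //; lra.
have : (q * y) ^+ 2 <= 1 by rewrite exprn_ile1 //; nra.
have : 0 <= q ^+ 5 by rewrite exprn_ge0 // ltW.
have : (1 / 8) ^+ 5 <= 1 / 32 :> R by lra.
nra.
Qed.

End Rates.

Unset Implicit Arguments.
Set Strict Implicit.

Theorem theorem4p1 (R : realType) (H T0 : nat) (gamma : nat -> R)
    (d : measure_display) (Omega : measurableType d) (P : probability Omega R)
    (dS : measure_display) (S : measurableType dS)
    (X : primitives H Omega S) (alg : bidder -> algorithm H S)
    (H_gt0 : (0 < H)%N) (H_even : ~~ odd H) (T0_gt0 : (0 < T0)%N)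
    (gamma_incr : forall s t : nat, (0 < s)%N -> (s <= t)%N ->
       gamma s * s%:R <= gamma t * t%:R)
    (gamma_lim : gamma @ \oo --> (0 : R))
    (X_law : primitives_law P X)
    (alg_meas : forall i : bidder, measurable_algorithm (alg i))
    (alg_mean_based : forall i : bidder, mean_based P T0 X alg gamma i)
    (T0_large : forall t : nat, (T0 <= t)%N -> gamma t <= 1 / (4 * H%:R ^+ 3)) :
  forall (t : nat) (i : bidder) (v : 'I_H), (T0 < t)%N ->
    1 - H%:R * gamma t
      - expR (- ((H%:R - 1) * T0%:R / (32 * (4 * H%:R ^+ 3 + 1) * H%:R ^+ 4)))
        * (ln t%:R / ln ((4 * H%:R ^+ 3 + H%:R) / (4 * H%:R ^+ 3 + 1)))
    <= cond_prob P
         [set o | grid R v / 2 <= grid R (bid T0 X alg i t o)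
                               < grid R v / 2 + 1 / H%:R]
         [set o | value X i t o = v].
Proof.
(* From here on the round is [t.+1] and [t] is the length of its past. *)
move=> [//|t] i v lt_t; rewrite ltnS in lt_t.
have H_ge2 : (2 <= H)%N by exact: even_ge2.
have gamma_nonneg s : (T0 <= s)%N -> 0 <= gamma s.
  exact: (gamma_ge0 X_law alg_meas H_gt0 T0_gt0 alg_mean_based).
have := best_bid_prob X_law alg_meas H_gt0 H_even T0_gt0 alg_mean_based
  T0_large i v lt_t.
set goal_prob := cond_prob _ _ _ => prob_ge.
set B := (X in _ - X).
have gt_ge0 : 0 <= gamma t.+1 := gamma_nonneg _ (leqW lt_t).
have gt'_ge0 : 0 <= gamma t := gamma_nonneg _ lt_t.
have H_ge0 : 0 <= H%:R :> R by [].
(* If [B >= 1], the claimed lower bound is at most 0, so only [B < 1] has content. *)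
have [B_ge1|B_lt1] := leP 1 B.
  apply: (@le_trans _ _ 0); first by have := mulr_ge0 H_ge0 gt_ge0; lra.
  by rewrite /goal_prob /cond_prob divr_ge0 // fine_ge0.
have [le_H err_le] := error_bound (R := R) H_ge2 T0_gt0 (lt_t : (T0 < t.+1)%N)
  erefl B_lt1.
apply: le_trans prob_ge.
move: err_le; rewrite -/B; set err := 2 * _ * _ => err_le.
have err_ge0 : 0 <= err.
  apply: mulr_ge0; first by rewrite mulr_ge0 // exprn_ge0.
  apply: divr_ge0; first by rewrite exprn_ge0 // expR_ge0.
  by rewrite subr_ge0 expR_le1 oppr_le0 divr_ge0 // mulr_ge0 // exprn_ge0.
(* The bid of round [t + 1] is controlled by [gamma t]; that one of the [H]
   bids is good pays for replacing [gamma t] by [gamma (t + 1)]. *)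
have shift : (H%:R - 1) * gamma t <= H%:R * gamma t.+1.
  have t_gt0 : 0 < t.+1%:R :> R by [].
  rewrite -(ler_pM2r t_gt0) -[X in _ <= X]mulrA.
  have t0 : (0 < t)%N := leq_trans T0_gt0 lt_t.
  (* Monotonicity of [gamma t * t] leaves [(H - 1)(t + 1) <= H t], that is [H <= t + 1], the first
     conclusion of [error_bound]. *)
  apply: (le_trans _ (ler_wpM2l H_ge0 (gamma_incr _ _ t0 (leqnSn t)))).
  have : H%:R <= t.+1%:R :> R by rewrite ler_nat.
  rewrite -natr1; nra.
have H1 : 0 <= H%:R - 1 :> R by rewrite subr_ge0 ler1n.
have := mulr_ge0 (mulr_ge0 H1 gt'_ge0) err_ge0.
lra.
Qed.
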